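(* Suppose $C_\infty$ is a $d$-variate extreme value copula such that for every $j=1,\dots,d$ the partial derivative $\dot C_{\infty,j}(\boldsymbol u)=\partial C_\infty(\boldsymbol u)/\partial u_j$ exists and is continuous on $\{\boldsymbol u\in[0,1]^d:u_j\in(0,1)\}$. With the centred Gaussian processes $\mathbb C^{\lozenge}(\cdot,1)$, $\mathbb C^{D}$, $\widehat{\mathbb C}^{\lozenge}(\cdot,1)$, $\widehat{\mathbb C}^{D}$ defined in the context, for any $k\in\mathbb N$ and $\boldsymbol u_1,\dots,\boldsymbol u_k\in[0,1]^d$, $$\operatorname{Cov}\Big(\widehat{\mathbb C}^{\lozenge}(\boldsymbol u_1,1),\dots,\widehat{\mathbb C}^{\lozenge}(\boldsymbol u_k,1)\Big)\le_L\operatorname{Cov}\Big(\widehat{\mathbb C}^{D}(\boldsymbol u_1),\dots,\widehat{\mathbb C}^{D}(\boldsymbol u_k)\Big)$$ and $$\operatorname{Cov}\Big(\mathbb C^{\lozenge}(\boldsymbol u_1,1),\dots,\mathbb C^{\lozenge}(\boldsymbol u_k,1)\Big)\le_L\operatorname{Cov}\Big(\mathbb C^{D}(\boldsymbol u_1),\dots,\mathbb C^{D}(\boldsymbol u_k)\Big),$$ where $\operatorname{Cov}(Y_1,\dots,Y_k)$ denotes the covariance matrix and $\le_L$ the Loewner ordering between symmetric matrices.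
   Context: An extreme value copula is a copula with $C_\infty(\boldsymbol u^{1/s})^s=C_\infty(\boldsymbol u)$ for all $s>0$, $\boldsymbol u\in[0,1]^d$. Powers and minima $\wedge$ of vectors are componentwise; $\boldsymbol u^{(j)}=(1,\dots,1,u_j,1,\dots,1)$ with $u_j$ in the $j$th coordinate; $\dot C_{\infty,j}(\boldsymbol u):=0$ if $u_j\in\{0,1\}$. $\mathbb C^{\lozenge}(\cdot,1)$ (limit of the empirical process of sliding block maxima) is a centred Gaussian process on $[0,1]^d$ with $$\operatorname{Cov}(\mathbb C^{\lozenge}(\boldsymbol u,1),\mathbb C^{\lozenge}(\boldsymbol v,1))=\int_{-1}^0C_\infty(\boldsymbol u)^{-\xi}C_\infty(\boldsymbol u\wedge\boldsymbol v)^{\xi+1}C_\infty(\boldsymbol v)^{-\xi}d\xi+\int_0^1C_\infty(\boldsymbol v)^{\xi}C_\infty(\boldsymbol u\wedge\boldsymbol v)^{1-\xi}C_\infty(\boldsymbol u)^{\xi}d\xi-2C_\infty(\boldsymbol u)C_\infty(\boldsymbol v).$$ $\mathbb C^{D}$ (limit for disjoint block maxima) is a centred Gaussian process on $[0,1]^d$ with $\operatorname{Cov}(\mathbb C^D(\boldsymbol u),\mathbb C^D(\boldsymbol v))=C_\infty(\boldsymbol u\wedge\boldsymbol v)-C_\infty(\boldsymbol u)C_\infty(\boldsymbol v)$. Further, $$\widehat{\mathbb C}^{\lozenge}(\boldsymbol u,1)=\mathbb C^{\lozenge}(\boldsymbol u,1)-\sum_{j=1}^d\dot C_{\infty,j}(\boldsymbol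 u)\mathbb C^{\lozenge}(\boldsymbol u^{(j)},1),\qquad \widehat{\mathbb C}^{D}(\boldsymbol u)=\mathbb C^{D}(\boldsymbol u)-\sum_{j=1}^d\dot C_{\infty,j}(\boldsymbol u)\mathbb C^{D}(\boldsymbol u^{(j)}).$$ *)

(* Defs.v *)
From HB Require Import structures.
From mathcomp Require Import all_boot all_order all_algebra.
From mathcomp Require Import all_classical all_reals all_analysis.
Set Implicit Arguments.
Unset Strict Implicit.
Unset Printing Implicit Defensive.
Import Order.TTheory GRing.Theory Num.Theory.
Import numFieldNormedType.Exports.
Local Open Scope classical_set_scope.
Local Open Scope ring_scope.

Definition cube (R : realType) (d : nat) : set 'rV[R]_d :=
  [set u | forall j, 0 <= u 0 j <= 1].

Definition vpow (R : realType) (d : nat) (u : 'rV[R]_d) (s : R) : 'rV[R]_d :=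
  map_mx (fun t => t `^ s) u.

Definition vmin (R : realType) (d : nat) (u v : 'rV[R]_d) : 'rV[R]_d :=
  map2_mx Num.min u v.

(* u^(j) = (1, ..., 1, u_j, 1, ..., 1) *)
Definition vmargin (R : realType) (d : nat) (j : 'I_d) (u : 'rV[R]_d) :
    'rV[R]_d :=
  \row_i (if i == j then u 0 i else 1).

(* A copula is the restriction to [0,1]^d of the joint cumulative distribution
   function of a random vector with standard uniform margins; the values of C
   outside the cube are irrelevant. *)
Definition is_copula (R : realType) (d : nat) (C : 'rV[R]_d -> R) : Prop :=
  exists (disp : measure_display) (T : measurableType disp)
    (P : probability T R) (U : 'I_d -> {RV P >-> R}),
    (forall (j : 'I_d) (A : set R), measurable A ->
       distribution P (U j) A = uniform_prob (@ltr01 R) A) /\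
    (forall u, cube u ->
       (C u)%:E = P [set w | forall j : 'I_d, U j w <= u 0 j]).

Definition is_extreme_value_copula (R : realType) (d : nat)
    (C : 'rV[R]_d -> R) : Prop :=
  is_copula C /\
  forall (s : R) (u : 'rV[R]_d), 0 < s -> cube u ->
    C (vpow u s^-1) `^ s = C u.

Definition pdiff_dom (R : realType) (d : nat) (j : 'I_d) : set 'rV[R]_d :=
  [set u | cube u /\ 0 < u 0 j < 1].

Definition has_continuous_partials (R : realType) (d : nat)
    (C : 'rV[R]_d -> R) : Prop :=
  forall j : 'I_d,
    (forall u, pdiff_dom j u -> derivable C u 'e_j) /\
    {within pdiff_dom j, continuous (fun u : 'rV[R]_d => 'D_('e_j) C u)}.

Definition pdot (R : realType) (d : nat) (C : 'rV[R]_d -> R) (j : 'I_d)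
    (u : 'rV[R]_d) : R :=
  if 0 < u 0 j < 1 then 'D_('e_j) C u else 0.

Definition cov_sliding (R : realType) (d : nat) (C : 'rV[R]_d -> R)
    (u v : 'rV[R]_d) : R :=
  \int[@lebesgue_measure R]_(x in `[-1, 0])
      (C u `^ (- x) * C (vmin u v) `^ (x + 1) * C v `^ (- x))
  + \int[@lebesgue_measure R]_(x in `[0, 1])
      (C v `^ x * C (vmin u v) `^ (1 - x) * C u `^ x)
  - 2 * C u * C v.

Definition cov_disjoint (R : realType) (d : nat) (C : 'rV[R]_d -> R)
    (u v : 'rV[R]_d) : R :=
  C (vmin u v) - C u * C v.

(* Normal law with mean m and standard deviation s.  The case s = 0 is treated
   separately because the library's normal_prob m 0 is not a point mass. *)
Definition gaussian_law (R : realType) (m s : R) (A : set R) : \bar R :=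
  if s == 0 then \d_m A else normal_prob m s A.

(* Gaussian process indexed by [0,1]^d: every finite linear combination of the
   variables X u, u in the cube, is (possibly degenerate) univariate normal. *)
Definition gaussian_process (R : realType) (d : nat) (disp : measure_display)
    (T : measurableType disp) (P : probability T R)
    (X : 'rV[R]_d -> {RV P >-> R}) : Prop :=
  forall (k : nat) (u : 'I_k -> 'rV[R]_d) (a : 'I_k -> R),
    (forall i, cube (u i)) ->
    exists m s : R, 0 <= s /\ forall A : set R, measurable A ->
      P ((fun w => \sum_(i < k) a i * X (u i) w) @^-1` A) = gaussian_law m s A.

Definition centred_gaussian_process (R : realType) (d : nat)
    (disp : measure_display) (T : measurableType disp) (P : probability T R)
    (X : 'rV[R]_d -> {RV P >-> R}) (K : 'rV[R]_d -> 'rV[R]_d -> R) : Prop :=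
  [/\ gaussian_process X,
      forall u, cube u -> ('E_P[X u] = 0)%E &
      forall u v, cube u -> cube v -> covariance P (X u) (X v) = (K u v)%:E].

Definition hat_process (R : realType) (d : nat) (disp : measure_display)
    (T : measurableType disp) (P : probability T R) (C : 'rV[R]_d -> R)
    (X : 'rV[R]_d -> {RV P >-> R}) (u : 'rV[R]_d) : T -> R :=
  fun w => X u w - \sum_(j < d) pdot C j u * X (vmargin j u) w.

Definition covmx (R : realType) (k : nat) (disp : measure_display)
    (T : measurableType disp) (P : probability T R) (Y : 'I_k -> T -> R) :
    'M[R]_k :=
  \matrix_(i, j) fine (covariance P (Y i) (Y j)).

Definition psdmx (R : realType) (k : nat) (A : 'M[R]_k) : Prop :=
  A^T = A /\ forall x : 'cV[R]_k, 0 <= (x^T *m A *m x) 0 0.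

Definition loewner_le (R : realType) (k : nat) (A B : 'M[R]_k) : Prop :=
  [/\ A^T = A, B^T = B & psdmx (B - A)].

(* Main.v *)
Require Import Defs.
From HB Require Import structures.
From mathcomp Require Import all_boot all_order all_algebra.
From mathcomp Require Import all_classical all_reals all_analysis.
From mathcomp Require Import measurable_realfun ring.
Import Order.TTheory GRing.Theory Num.Theory.
Import numFieldNormedType.Exports.
Local Open Scope classical_set_scope.
Local Open Scope ring_scope.

(** Write p = C(u) C(v) and q = C(u /\ v), with /\ the componentwise minimum.
    Both integrals in the sliding covariance can be brought to [0, 1], the
    first one by a unit translation, and their sum is then the integral of
    q^x p^(1-x) + p^x q^(1-x).  Since p^x p^(1-x) = p and
    q^x q^(1-x) = q, the difference of the two covariance kernels is
<<
      integral over [0, 1] of (q^x - p^x) (q^(1-x) - p^(1-x)) dx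
>>
    ([cov_disjointB_sliding]).

    Max-stability gives C(u)^x = C(u^x) for x > 0, and powers commute with
    componentwise minima, so that
<<
      q^x - p^x = C(u^x /\ v^x) - C(u^x) C(v^x)
>>
    is the covariance of the indicators of two lower orthants under the law
    with distribution function C.  For each x both factors are therefore
    positive semidefinite kernels in (u, v), their pointwise product is
    positive semidefinite by Schur's product theorem, and integration in x
    preserves this ([cov_disjointB_sliding_psd]).

    Here one factor is a Gram kernel E[f_i f_j], and for such a factor
    Schur's theorem is elementary: the quadratic form of
    E[f_i f_j] H_ij at a is the expectation of the quadratic form of H at the
    random vector (a_i f_i) ([psd_kernel_events_schur]).

    The vectors on both sides of the theorem, with or without the correction
    by partial derivatives, are the same finite linear combinations of the two
    processes at points of the cube.  By bilinearity of the covariance, the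
    quadratic form of the difference of their covariance matrices is a
    quadratic form of the difference kernel ([loewner_le_lincomb]). *)

(** * Finite sums and translations under the integral *)

Lemma integrable_EFin_sum {d} {T : measurableType d} {R : realType}
    (mu : {measure set T -> \bar R}) (D : set T) (I : Type) (s : seq I)
    (f : I -> T -> R) (mD : measurable D)
    (intf : forall i, mu.-integrable D (EFin \o f i)) :
  mu.-integrable D (EFin \o (fun x => \sum_(i <- s) f i x)).
Proof.
rewrite (_ : EFin \o _ = fun x => (\sum_(i <- s) (EFin \o f i) x)%E).
  exact: integrable_sum.
by apply/funext => x /=; rewrite sumEFin.
Qed.

Lemma Rintegral_sum {d} {T : measurableType d} {R : realType}
    (mu : {measure set T -> \bar R}) (D : set T) (I : Type) (s : seq I)
    (f : I -> T -> R) (mD : measurable D)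
    (intf : forall i, mu.-integrable D (EFin \o f i)) :
  \int[mu]_(x in D) (\sum_(i <- s) f i x) =
  \sum_(i <- s) \int[mu]_(x in D) f i x.
Proof.
elim: s => [|i s IHs].
  under eq_Rintegral do rewrite big_nil.
  by rewrite big_nil /Rintegral integral0.
under eq_Rintegral do rewrite big_cons.
by rewrite RintegralD ?IHs ?big_cons//; exact: integrable_EFin_sum.
Qed.

(** Stated on [measurableTypeR], the Borel structure carried by the domain of
    [lebesgue_measure], so that it can be used to push that measure forward. *)
Lemma measurable_shift {R : realType} (c : R) :
  @measurable_fun _ _ (measurableTypeR R) (measurableTypeR R) setT
    (fun x => x + c).
Proof. by apply: measurable_funD => //; exact: measurable_cst. Qed.

(** A translation preserves the length of half-open intervals, and these
    determine the measure. *)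
Lemma lebesgue_measure_shift {R : realType} (c : R) (A : set R) :
  measurable A ->
  pushforward (@lebesgue_measure R)
    ((fun x => x + c) : _ -> measurableTypeR R) A = lebesgue_measure A.
Proof.
move=> mA; have mshift := measurable_shift c; apply/esym.
pose ms := @isMeasurableFun.Build _ _ (measurableTypeR R) (measurableTypeR R)
  (fun x => x + c) mshift.
pose f : {mfun measurableTypeR R >-> measurableTypeR R} :=
  HB.pack (fun x : measurableTypeR R => (x + c : measurableTypeR R)) ms.
pose mu : {measure set (measurableTypeR R) -> \bar R} := lebesgue_measure.
apply: (lebesgue_measure_unique (mu := pushforward mu f)) => //= _ [[a b]] _ <-.
rewrite /pushforward (_ : _ @^-1` _ = `]a - c, b - c]%classic); last first.
  by apply/seteqP; split => x /=; rewrite !in_itv/= ltrBlDr lerBrDr.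
by rewrite !lebesgue_measure_itv/= !lte_fin ltrD2r -!EFinB opprB addrA subrK.
Qed.

Lemma ge0_Rintegral_shift {R : realType} (f : R -> R) (a b c : R) :
  measurable_fun [set: R] f -> (forall x, 0 <= f x) ->
  \int[@lebesgue_measure R]_(x in `[a, b]) f (x + c) =
  \int[@lebesgue_measure R]_(x in `[a + c, b + c]) f x.
Proof.
move=> mf f0; rewrite /Rintegral; congr fine.
rewrite (_ : `[a, b]%classic = ((fun x => x + c) : _ -> measurableTypeR R)
    @^-1` `[a + c, b + c]); last first.
  by apply/seteqP; split => x /=; rewrite !in_itv/= !lerD2r.
have mshift := measurable_shift c.
rewrite -(ge0_integral_pushforward mshift
  (lebesgue_measure : {measure set (measurableTypeR R) -> \bar R})
  (f := EFin \o f))//=.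
- by apply: eq_measure_integral => // A mA _; exact: lebesgue_measure_shift.
- by apply/measurable_EFinP; exact: measurable_funTS.
- by move=> x _; rewrite lee_fin.
Qed.

(** * Positive semidefinite kernels *)

Definition psd_kernel {R : realType} {I : finType} (K : I -> I -> R) : Prop :=
  forall a : I -> R, 0 <= \sum_i \sum_j a i * a j * K i j.

Lemma psd_kernel1 {R : realType} {I : finType} :
  psd_kernel (fun _ _ : I => 1 : R).
Proof.
move=> a; rewrite (_ : \sum_i _ = (\sum_i a i) ^+ 2) ?sqr_ge0//.
rewrite expr2 mulr_suml; apply: eq_bigr => i _.
by rewrite mulr_sumr; apply: eq_bigr => j _; rewrite mulr1.
Qed.

Lemma psd_kernel_Rintegral {d} {T : measurableType d} {R : realType}
    (mu : {measure set T -> \bar R}) (D : set T) {I : finType}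
    (K : T -> I -> I -> R) (mD : measurable D)
    (intK : forall i j, mu.-integrable D (EFin \o (fun x => K x i j)))
    (psdK : forall x, D x -> psd_kernel (K x)) :
  psd_kernel (fun i j => \int[mu]_(x in D) K x i j).
Proof.
move=> a.
have intaK i j : mu.-integrable D (EFin \o (fun x => a i * a j * K x i j)).
  by apply: (integrableZl mD (a i * a j) (intK i j)).
under eq_bigr do under eq_bigr do rewrite -RintegralZl//.
under eq_bigr do rewrite -Rintegral_sum//.
rewrite -Rintegral_sum//; last first.
  by move=> i; exact: integrable_EFin_sum.
by apply: Rintegral_ge0 => x Dx; exact: psdK.
Qed.

(** The factor [c] will be an entry of a kernel; carrying it here lets the
    Schur product be recognised as a single integral. *)
Lemma integral_centred_indic_prod {d} {T : measurableType d} {R : realType}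
    (P : probability T R) (A B : set T) (c : R) :
  measurable A -> measurable B ->
  let f w := (\1_A w - fine (P A)) * (\1_B w - fine (P B)) * c in
  P.-integrable setT (EFin \o f) /\
  \int[P]_w f w = (fine (P (A `&` B)) - fine (P A) * fine (P B)) * c.
Proof.
move=> mA mB f; set a := fine (P A) in f *; set b := fine (P B) in f *.
have int1 (k : R) D : measurable D ->
    P.-integrable setT (EFin \o (fun w => k * \1_D w)).
  move=> mD; have i1 := @integrable_indic _ _ _ P _ mD.
  exact: (integrableZl measurableT k i1).
have intc (k : R) : P.-integrable setT (EFin \o cst k).
  exact: finite_measure_integrable_cst.
have int1E (k : R) D : measurable D -> \int[P]_w (k * \1_D w) = k * fine (P D).
  move=> mD; rewrite RintegralZl//; last exact: (@integrable_indic _ _ _ P).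
  by rewrite /Rintegral integral_indic// setIT.
pose m := a * b * c.
have fE : f = fun w => (c * \1_(A `&` B) w + (- (b * c)) * \1_A w)
    + ((- (a * c)) * \1_B w + m).
  by apply/funext => w; rewrite /f /m indicI /=; ring.
have i1 : P.-integrable setT
    (EFin \o (fun w => c * \1_(A `&` B) w + (- (b * c)) * \1_A w)).
  apply: (@eq_integrable _ _ _ _ _ measurableT
    (fun w => (c * \1_(A `&` B) w)%:E + ((- (b * c)) * \1_A w)%:E)%E) => //.
  by apply: integrableD => //; apply: int1 => //; exact: measurableI.
have i2 : P.-integrable setT (EFin \o (fun w => (- (a * c)) * \1_B w + m)).
  apply: (@eq_integrable _ _ _ _ _ measurableT
    (fun w => ((- (a * c)) * \1_B w)%:E + m%:E)%E) => //.
  by apply: integrableD => //; [exact: int1|exact: intc].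
split.
  rewrite fE; apply: (@eq_integrable _ _ _ _ _ measurableT (fun w =>
    (c * \1_(A `&` B) w + (- (b * c)) * \1_A w)%:E
    + ((- (a * c)) * \1_B w + m)%:E)%E) => //.
  exact: integrableD.
rewrite fE RintegralD//.
have mAB : measurable (A `&` B) by exact: measurableI.
rewrite (RintegralD measurableT (int1 _ _ mAB) (int1 _ _ mA)) !int1E//.
rewrite (RintegralD measurableT (int1 _ _ mB) (intc _)) int1E//.
have PT : fine (P [set: T]) = 1 by rewrite probability_setT.
have -> : \int[P]_(_ in setT) m = m by rewrite Rintegral_cst// PT mulr1.
by rewrite -/a -/b /m; ring.
Qed.

(** Schur's product theorem when one factor is the covariance kernel of
    indicators: with f_i the centred indicator of [A i], the form at [a] is the
    expectation of the form of [H] at the random vector (a_i f_i). *)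
Lemma psd_kernel_events_schur {d} {T : measurableType d} {R : realType}
    (P : probability T R) {I : finType} (A : I -> set T) (H : I -> I -> R)
    (mA : forall i, measurable (A i)) (psdH : psd_kernel H) :
  psd_kernel (fun i j =>
    (fine (P (A i `&` A j)) - fine (P (A i)) * fine (P (A j))) * H i j).
Proof.
pose f w i j := (\1_(A i) w - fine (P (A i))) * (\1_(A j) w - fine (P (A j)))
  * H i j.
have fE i j := @integral_centred_indic_prod _ _ _ P _ _ (H i j) (mA i) (mA j).
have -> : (fun i j => (fine (P (A i `&` A j)) - fine (P (A i)) * fine (P (A j)))
    * H i j) = fun i j => \int[P]_w f w i j.
  by apply/funext => i; apply/funext => j; case: (fE i j).
apply: psd_kernel_Rintegral => // [i j|w _ a]; first by case: (fE i j).
have := psdH (fun i => a i * (\1_(A i) w - fine (P (A i)))).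
congr (_ <= _); apply: eq_bigr => i _; apply: eq_bigr => j _; rewrite /f; ring.
Qed.

(** * Powers of extreme value copulas *)

Lemma powR_le1 {R : realType} (a x : R) :
  0 <= x -> 0 <= a -> a <= 1 -> a `^ x <= 1.
Proof.
move=> x0 a0 a1; have -> : 1 = (1 : R) `^ x by rewrite powR1.
by rewrite ge0_ler_powR// nnegrE.
Qed.

Lemma vpow_cube {R : realType} {d : nat} (u : 'rV[R]_d) (x : R) :
  0 <= x -> cube u -> cube (vpow u x).
Proof.
move=> x0 cu j; have /andP[u0 u1] := cu j.
by rewrite mxE powR_ge0/= powR_le1.
Qed.

Lemma vmin_cube {R : realType} {d : nat} (u v : 'rV[R]_d) :
  cube u -> cube v -> cube (vmin u v).
Proof.
move=> cu cv j; rewrite mxE.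
by have [_|_] := leP (u 0 j) (v 0 j); [exact: cu|exact: cv].
Qed.

Lemma vmargin_cube {R : realType} {d : nat} (j : 'I_d) (u : 'rV[R]_d) :
  cube u -> cube (vmargin j u).
Proof. by move=> cu i; rewrite mxE; case: ifP => // _; rewrite ler01 lexx. Qed.

Lemma vpow_vmin {R : realType} {d : nat} (u v : 'rV[R]_d) (x : R) :
  0 <= x -> cube u -> cube v -> vpow (vmin u v) x = vmin (vpow u x) (vpow v x).
Proof.
move=> x0 cu cv; apply/rowP => j; rewrite !mxE.
have /andP[u0 _] := cu j; have /andP[v0 _] := cv j.
have mono : {in Num.nneg &, {homo (fun t : R => t `^ x) : a b / a <= b}}.
  by move=> a b a0 b0 ab; rewrite ge0_ler_powR.
have [uv|/ltW vu] := leP (u 0 j) (v 0 j).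
  by rewrite min_l// mono// nnegrE.
by rewrite min_r// mono// nnegrE.
Qed.

(** A copula is the probability of lower orthants, and orthants are stable
    under intersection: this is what turns [C (vmin u v)] into the probability
    of a joint event. *)
Lemma copula_orthant_events {R : realType} {d : nat} {C : 'rV[R]_d -> R} :
  is_copula C ->
  exists (disp : measure_display) (T : measurableType disp)
    (P : probability T R) (A : 'rV[R]_d -> set T),
    [/\ forall u, measurable (A u),
        forall u v, A u `&` A v = A (vmin u v) &
        forall u, cube u -> C u = fine (P (A u))].
Proof.
move=> [disp [T [P [U [_ CE]]]]]; exists disp, T, P.
pose A (u : 'rV[R]_d) : set T := [set t | forall j : 'I_d, U j t <= u 0 j].
exists A; split => [u|u v|u cu]; last by rewrite -CE.
- rewrite (_ : A u =
      \bigcap_(j in [set: 'I_d]) (U j @^-1` `]-oo, u 0 j]%classic)).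
    apply: fin_bigcap_measurable => // j _.
    rewrite -[X in measurable X]setTI; exact: measurable_funPT.
  apply/seteqP; split => [t At j _ /=|t At j]; first by rewrite in_itv/=.
  by have := At j Logic.I; rewrite /= in_itv.
- apply/seteqP; split => [t [Au Av] j|t Auv].
    by rewrite mxE le_min Au Av.
  by split=> j; have := Auv j; rewrite mxE le_min => /andP[].
Qed.

Lemma copula_ge0_le1 {R : realType} {d : nat} {C : 'rV[R]_d -> R} :
  is_copula C -> forall u, cube u -> 0 <= C u <= 1.
Proof.
move=> /copula_orthant_events[disp [T [P [A [mA _ CE]]]]] u cu.
rewrite CE// fine_ge0//= -lee_fin fineK ?fin_num_measure//.
exact: probability_le1.
Qed.

Lemma copula_psd_schur {R : realType} {d : nat} {C : 'rV[R]_d -> R}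
    {I : finType} (w : I -> 'rV[R]_d) (H : I -> I -> R) :
  is_copula C -> (forall i, cube (w i)) -> psd_kernel H ->
  psd_kernel (fun i j =>
    (C (vmin (w i) (w j)) - C (w i) * C (w j)) * H i j).
Proof.
move=> /copula_orthant_events[disp [T [P [A [mA Amin CE]]]]] cw psdH.
have := psd_kernel_events_schur P _ H (fun i => mA (w i)) psdH.
congr psd_kernel; apply/funext => i; apply/funext => j.
by rewrite Amin -!CE//; exact: vmin_cube.
Qed.

(** Max-stability, applied with exponent 1/x and raised to the power x. *)
Lemma evc_powR {R : realType} {d : nat} {C : 'rV[R]_d -> R} :
  is_extreme_value_copula C -> forall u x, 0 < x -> cube u ->
  C u `^ x = C (vpow u x).
Proof.
move=> [Ccop maxst] u x x0 cu.
have cux : cube (vpow u x) by apply: vpow_cube => //; exact: ltW.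
have /andP[Cux0 _] := copula_ge0_le1 Ccop _ cux.
rewrite -(maxst x^-1 u) ?invr_gt0// invrK -powRrM mulVf ?gt_eqF//.
by rewrite powRr1.
Qed.

(** For x > 0 the kernel q^x - p^x is the orthant covariance kernel of [C] at
    the points [vpow (w i) x].  The exponent 0 is included because the
    integration below runs over the closed interval [0, 1]. *)
Lemma evc_powR_psd_schur {R : realType} {d : nat} {C : 'rV[R]_d -> R}
    {I : finType} (w : I -> 'rV[R]_d) (x : R) (H : I -> I -> R) :
  is_extreme_value_copula C -> (forall i, cube (w i)) -> 0 <= x ->
  psd_kernel H ->
  psd_kernel (fun i j =>
    (C (vmin (w i) (w j)) `^ x - (C (w i) * C (w j)) `^ x) * H i j).
Proof.
move=> Cevc cw; rewrite le_eqVlt => /predU1P[<- _ a|x0 psdH].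
  (* t `^ 0 = 1 even for t = 0, so the first factor is 0. *)
  rewrite (_ : \sum_i _ = 0)// big1// => i _; rewrite big1// => j _.
  by rewrite !powRr0 subrr mul0r mulr0.
have [Ccop _] := Cevc.
have := @copula_psd_schur _ _ _ _ (fun i => vpow (w i) x) H Ccop _ psdH.
rewrite (_ : (fun i j => _) = (fun i j =>
    (C (vmin (w i) (w j)) `^ x - (C (w i) * C (w j)) `^ x) * H i j)).
  by apply=> i; apply: vpow_cube => //; exact: ltW.
apply/funext => i; apply/funext => j.
have /andP[Ci _] := copula_ge0_le1 Ccop _ (cw i).
have /andP[Cj _] := copula_ge0_le1 Ccop _ (cw j).
rewrite powRM// !(evc_powR Cevc)// ?vpow_vmin//; last exact: vmin_cube.
exact: ltW.
Qed.

(** * The difference of the two covariance kernels *)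

(** Valid for every exponent and also for [a = 0]: the exponents add up to 1,
    which is nonzero, so the addition rule for powers needs no positivity. *)
Lemma powR_onemM {R : realType} (a x : R) :
  0 <= a -> a `^ x * a `^ (1 - x) = a.
Proof.
move=> a0; have x1 : x + (1 - x) = 1 by rewrite addrC subrK.
rewrite -[RHS]powRr1// -[in RHS]x1 [RHS]powRD//.
by rewrite x1; apply/implyP => /eqP/esym/eqP; rewrite eq_sym oner_eq0.
Qed.

Lemma integrable_itv01 {R : realType} (f : R -> R) (M : R) :
  measurable_fun [set: R] f ->
  (forall x, 0 <= x <= 1 -> `|f x| <= M) ->
  (@lebesgue_measure R).-integrable `[0, 1] (EFin \o f).
Proof.
move=> mf fM; apply: measurable_bounded_integrable => //.
- by rewrite /= lebesgue_measure_itv/= lte01 ltry.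
- by apply: measurable_funTS; exact: mf.
exists M; split; [by rewrite num_real|move=> N MN x /=].
by rewrite in_itv/= => x01; rewrite (le_trans (fM x x01))// ltW.
Qed.

Lemma Rintegral_itv01_cstBD {R : realType} (c : R) (f g : R -> R) :
  measurable_fun [set: R] f -> measurable_fun [set: R] g ->
  (forall x, 0 <= x <= 1 -> `|f x| <= 1) ->
  (forall x, 0 <= x <= 1 -> `|g x| <= 1) ->
  let h x := c - (f x + g x) in
  (@lebesgue_measure R).-integrable `[0, 1] (EFin \o h) /\
  \int[@lebesgue_measure R]_(x in `[0, 1]) h x =
  c - (\int[@lebesgue_measure R]_(x in `[0, 1]) f x +
       \int[@lebesgue_measure R]_(x in `[0, 1]) g x).
Proof.
move=> mf mg f1 g1 h.
have mfg : measurable_fun [set: R] (f \+ g) by exact: measurable_funD.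
have fg2 x : 0 <= x <= 1 -> `|(f \+ g) x| <= 1 + 1.
  move=> x01; apply: (le_trans (ler_normD _ _)).
  by apply: lerD; [exact: f1|exact: g1].
have mc : measurable_fun [set: R] (fun=> c) by exact: measurable_cst.
split.
  apply: (integrable_itv01 h (`|c| + (1 + 1))).
    exact: measurable_funB mc mfg.
  move=> x x01; apply: (le_trans (ler_normB _ _)).
  by apply: lerD => //; exact: fg2.
rewrite /h RintegralB//; last 2 first.
- by apply: (integrable_itv01 (fun=> c) `|c|).
- exact: (integrable_itv01 (f \+ g) (1 + 1)).
rewrite RintegralD//; last 2 first.
- exact: (integrable_itv01 f 1).
- exact: (integrable_itv01 g 1).
congr (_ - _); rewrite Rintegral_cst//=.
by rewrite lebesgue_measure_itv/= lte01 oppr0 adde0 mulr1.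
Qed.

Definition geom_interp {R : realType} (a b x : R) : R := a `^ x * b `^ (1 - x).

Lemma measurable_geom_interp {R : realType} (a b : R) :
  measurable_fun [set: R] (geom_interp a b).
Proof.
apply: measurable_funM; first exact: measurable_powRr.
apply: (measurableT_comp (measurable_powRr b)).
by apply: measurable_funB => //; exact: measurable_cst.
Qed.

Lemma geom_interp_ge0 {R : realType} (a b x : R) : 0 <= geom_interp a b x.
Proof. by rewrite mulr_ge0 ?powR_ge0. Qed.

Lemma geom_interp_norm_le1 {R : realType} (a b x : R) :
  0 <= a <= 1 -> 0 <= b <= 1 -> 0 <= x <= 1 -> `|geom_interp a b x| <= 1.
Proof.
move=> /andP[a0 a1] /andP[b0 b1] /andP[x0 x1].
rewrite ger0_norm ?geom_interp_ge0//.
by rewrite mulr_ile1 ?powR_ge0// powR_le1 ?subr_ge0.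
Qed.

Lemma powR_diffM {R : realType} (p q x : R) : 0 <= p -> 0 <= q ->
  (q `^ x - p `^ x) * (q `^ (1 - x) - p `^ (1 - x)) =
  p + q - (geom_interp q p x + geom_interp p q x).
Proof.
move=> p0 q0; transitivity (p `^ x * p `^ (1 - x) + q `^ x * q `^ (1 - x)
    - (geom_interp q p x + geom_interp p q x)); last by rewrite !powR_onemM.
by rewrite /geom_interp; ring.
Qed.

(** The integrand is [powR_diffM] at p = C u * C v and q = C (vmin u v).  The
    constant p + q = q - p + 2 p absorbs both products of the covariances:
    - p from the disjoint one and + 2 p from the sliding one. *)
Lemma cov_disjointB_sliding {R : realType} {d : nat} {C : 'rV[R]_d -> R}
    (u v : 'rV[R]_d) (Ccop : is_copula C) (cu : cube u) (cv : cube v) :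
  let f x := (C (vmin u v) `^ x - (C u * C v) `^ x)
    * (C (vmin u v) `^ (1 - x) - (C u * C v) `^ (1 - x)) in
  (@lebesgue_measure R).-integrable `[0, 1] (EFin \o f) /\
  cov_disjoint C u v - cov_sliding C u v =
  \int[@lebesgue_measure R]_(x in `[0, 1]) f x.
Proof.
rewrite /cov_disjoint /cov_sliding.
have /andP[] := copula_ge0_le1 Ccop _ (vmin_cube _ _ cu cv).
have /andP[] := copula_ge0_le1 Ccop _ cu.
have /andP[] := copula_ge0_le1 Ccop _ cv.
(* Only the three values of the copula matter from here on. *)
move: (C u) (C v) (C (vmin u v)) => a b q b0 b1 a0 a1 q0 q1.
have pM y : (a * b) `^ y = a `^ y * b `^ y by exact: powRM.
have p01 : 0 <= a * b <= 1 by rewrite mulr_ge0// mulr_ile1.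
have q01 : 0 <= q <= 1 by rewrite q0.
(* Substituting x + 1 for the variable of the integral over [-1, 0]. *)
have first : \int[@lebesgue_measure R]_(x in `[-1, 0])
    (a `^ (- x) * q `^ (x + 1) * b `^ (- x)) =
    \int[@lebesgue_measure R]_(x in `[0, 1]) geom_interp q (a * b) x.
  have := @ge0_Rintegral_shift R (geom_interp q (a * b)) (-1) 0 1
    (measurable_geom_interp _ _) (geom_interp_ge0 _ _).
  rewrite addNr add0r => <-; apply: eq_Rintegral => x _.
  rewrite /geom_interp opprD addrCA subrr addr0 pM; ring.
have second : \int[@lebesgue_measure R]_(x in `[0, 1])
    (b `^ x * q `^ (1 - x) * a `^ x) =
    \int[@lebesgue_measure R]_(x in `[0, 1]) geom_interp (a * b) q x.
  by apply: eq_Rintegral => x _; rewrite /geom_interp pM; ring.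
have fE : (fun x => (q `^ x - (a * b) `^ x)
      * (q `^ (1 - x) - (a * b) `^ (1 - x))) = fun x =>
    a * b + q - (geom_interp q (a * b) x + geom_interp (a * b) q x).
  apply/funext => x; exact: powR_diffM (mulr_ge0 a0 b0) q0.
have [intf intfE] := Rintegral_itv01_cstBD (a * b + q) _ _
  (measurable_geom_interp q (a * b)) (measurable_geom_interp (a * b) q)
  (fun x => geom_interp_norm_le1 q (a * b) x q01 p01)
  (fun x => geom_interp_norm_le1 (a * b) q x p01 q01).
rewrite fE first second; split; first exact: intf.
rewrite intfE; set I1 := \int[_]_(x in _) _ x; set I2 := \int[_]_(x in _) _ x.
by move: I1 I2 => I1 I2; ring.
Qed.

Lemma cov_disjointB_sliding_psd {R : realType} {d : nat} {C : 'rV[R]_d -> R}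
    {I : finType} (w : I -> 'rV[R]_d) :
  is_extreme_value_copula C -> (forall i, cube (w i)) ->
  psd_kernel (fun i j =>
    cov_disjoint C (w i) (w j) - cov_sliding C (w i) (w j)).
Proof.
move=> Cevc cw; have [Ccop _] := Cevc.
pose q i j := C (vmin (w i) (w j)); pose p i j := C (w i) * C (w j).
pose K x i j :=
  (q i j `^ x - p i j `^ x) * (q i j `^ (1 - x) - p i j `^ (1 - x)).
have E i j := cov_disjointB_sliding (w i) (w j) Ccop (cw i) (cw j).
have -> : (fun i j => cov_disjoint C (w i) (w j) - cov_sliding C (w i) (w j))
    = fun i j => \int[@lebesgue_measure R]_(x in `[0, 1]) K x i j.
  by apply/funext => i; apply/funext => j; case: (E i j).
apply: psd_kernel_Rintegral => // [i j|x]; first by case: (E i j).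
rewrite /= in_itv/= => /andP[x0 x1].
apply: evc_powR_psd_schur => //.
(* The second factor is itself psd: its Schur product with the kernel 1. *)
have := @evc_powR_psd_schur _ _ C _ w (1 - x) (fun _ _ => 1) Cevc cw.
rewrite subr_ge0 => /(_ x1 psd_kernel1).
by under eq_fun do under eq_fun do rewrite mulr1.
Qed.

(** * Covariances of linear combinations *)

Lemma Lfun2_lincomb {d} {T : measurableType d} {R : realType}
    (P : probability T R) (J : Type) (s : seq J) (c : J -> R)
    (X : J -> T -> R) :
  (forall o, X o \in Lfun P 2%:E) ->
  (fun t => \sum_(o <- s) c o * X o t) \in Lfun P 2%:E.
Proof.
move=> X2; rewrite (_ : (fun t => _) = \sum_(o <- s) (c o \o* X o)).
  apply: rpred_sum => [|p1 o _]; first by rewrite lee_fin ler1n.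
  by apply: Lfun_scale; rewrite ?ler1n.
by apply/funext => t; rewrite fct_sumE; apply: eq_bigr => o _ /=; rewrite mulrC.
Qed.

Lemma covariance_suml {d} {T : measurableType d} {R : realType}
    (P : probability T R) (J : Type) (s : seq J) (c : J -> R)
    (X : J -> T -> R) (Z : T -> R) :
  (forall o, X o \in Lfun P 2%:E) -> Z \in Lfun P 2%:E ->
  covariance P (fun t => \sum_(o <- s) c o * X o t) Z =
  (\sum_(o <- s) (c o)%:E * covariance P (X o) Z)%E.
Proof.
move=> X2 Z2; have PT : P setT \is a fin_num := fin_num_measure P _ measurableT.
have cX2 o : c o \o* X o \in Lfun P 2%:E.
  by apply: Lfun_scale => //; rewrite ler1n.
have sum2 r := Lfun2_lincomb P J r c X X2.
elim: s => [|o s IHs].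
  under eq_fun do rewrite big_nil.
  by rewrite big_nil covariance_cst_l.
rewrite big_cons -IHs.
rewrite -covarianceZl; last 3 first.
- exact: Lfun_subset12.
- exact: Lfun_subset12.
- exact: Lfun2_mul_Lfun1.
rewrite -covarianceDl//; congr covariance.
by apply/funext => t; rewrite big_cons /= mulrC.
Qed.

(** The mean vanishes, so the second moment is the variance [K u u], which is
    a real number. *)
Lemma centred_process_Lfun2 {R : realType} {d : nat} {disp : measure_display}
    {T : measurableType disp} (P : probability T R)
    (X : 'rV[R]_d -> {RV P >-> R}) (K : 'rV[R]_d -> 'rV[R]_d -> R)
    (u : 'rV[R]_d) :
  centred_gaussian_process X K -> cube u -> (X u : T -> R) \in Lfun P 2%:E.
Proof.
move=> [_ EX covX] cu; have := covX _ _ cu cu.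
rewrite unlock EX//= => EX2.
have mX : measurable_fun setT (X u) by exact: measurable_funPT.
apply/andP; split; rewrite inE//=.
rewrite /finite_norm unlock; apply: poweR_lty.
rewrite (_ : \int[P]_x _ = (K u u)%:E)%E ?ltry// -EX2 unlock.
apply: eq_integral => t _ /=.
rewrite powR_mulrn// real_normK ?num_real//.
by transitivity ((X u t - 0) * (X u t - 0))%:E => //; rewrite subr0 expr2.
Qed.

Lemma covmx_lincomb {R : realType} {d : nat} {disp : measure_display}
    {T : measurableType disp} (P : probability T R)
    (X : 'rV[R]_d -> {RV P >-> R}) (K : 'rV[R]_d -> 'rV[R]_d -> R)
    {k : nat} {J : finType} (c : 'I_k -> J -> R) (w : 'I_k -> J -> 'rV[R]_d) :
  centred_gaussian_process X K -> (forall i o, cube (w i o)) ->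
  covmx P (fun i t => \sum_o c i o * X (w i o) t) =
  \matrix_(i, j) \sum_o \sum_o' c i o * c j o' * K (w i o) (w j o').
Proof.
move=> gX cw; have [_ _ covX] := gX.
have X2 i o := centred_process_Lfun2 P X K _ gX (cw i o).
have S2 i := Lfun2_lincomb P J (index_enum J) (c i) _ (X2 i).
apply/matrixP => i j; rewrite !mxE.
rewrite covariance_suml//.
under eq_bigr => o _.
  rewrite covarianceC covariance_suml//.
  under eq_bigr do rewrite covarianceC covX// -EFinM.
  rewrite sumEFin -EFinM mulr_sumr.
  over.
rewrite sumEFin; apply: eq_bigr => o _; apply: eq_bigr => o' _.
by rewrite mulrA.
Qed.

Lemma mulmx_quadE {R : realType} {k : nat} (M : 'M[R]_k) (x : 'cV[R]_k) :
  (x^T *m M *m x) 0 0 = \sum_i \sum_j x i 0 * x j 0 * M i j.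
Proof.
rewrite mxE; under eq_bigr do rewrite mxE mulr_suml.
rewrite exchange_big/=; apply: eq_bigr => i _; apply: eq_bigr => j _.
by rewrite mxE mulrAC.
Qed.

(** The form of the difference matrix at [x] is the form of the difference
    kernel on the index set ['I_k * J], at the coefficients x_i c_(i,o). *)
Lemma loewner_le_lincomb {R : realType} {d : nat} {C : 'rV[R]_d -> R}
    (hC : is_extreme_value_copula C)
    {disp1 : measure_display} {T1 : measurableType disp1}
    {P1 : probability T1 R} {CS : 'rV[R]_d -> {RV P1 >-> R}}
    (hCS : centred_gaussian_process CS (cov_sliding C))
    {disp2 : measure_display} {T2 : measurableType disp2}
    {P2 : probability T2 R} {CD : 'rV[R]_d -> {RV P2 >-> R}}
    (hCD : centred_gaussian_process CD (cov_disjoint C))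
    {k : nat} {J : finType} (c : 'I_k -> J -> R) (w : 'I_k -> J -> 'rV[R]_d)
    (cw : forall i o, cube (w i o)) :
  loewner_le (covmx P1 (fun i t => \sum_o c i o * CS (w i o) t))
             (covmx P2 (fun i t => \sum_o c i o * CD (w i o) t)).
Proof.
have sym (disp : measure_display) (T : measurableType disp)
    (P : probability T R) (Y : 'I_k -> T -> R) : (covmx P Y)^T = covmx P Y.
  by apply/matrixP => i j; rewrite !mxE covarianceC.
split; [exact: sym|exact: sym|split; first by rewrite linearB/= !sym].
move=> x; rewrite mulmx_quadE.
rewrite (covmx_lincomb _ _ _ _ _ hCS cw) (covmx_lincomb _ _ _ _ _ hCD cw).
pose D u v := cov_disjoint C u v - cov_sliding C u v.
have := cov_disjointB_sliding_psd (fun io : 'I_k * J => w io.1 io.2) hC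
  (fun io => cw io.1 io.2) (fun io => x io.1 0 * c io.1 io.2).
congr (_ <= _).
transitivity (\sum_i \sum_o \sum_j \sum_o'
    x i 0 * c i o * (x j 0 * c j o') * D (w i o) (w j o')).
  by rewrite [RHS]pair_bigA; apply: eq_bigr => io _; rewrite [RHS]pair_bigA.
apply: eq_bigr => i _; rewrite exchange_big/=; apply: eq_bigr => j _.
rewrite !mxE -sumrB mulr_sumr; apply: eq_bigr => o _.
rewrite -sumrB mulr_sumr; apply: eq_bigr => o' _.
rewrite /D -mulrBr; ring.
Qed.

Theorem theorem2p12 (R : realType) (d : nat) (C : 'rV[R]_d -> R)
    (hC : is_extreme_value_copula C) (hdC : has_continuous_partials C)
    (disp1 : measure_display) (T1 : measurableType disp1)
    (P1 : probability T1 R) (CS : 'rV[R]_d -> {RV P1 >-> R})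
    (hCS : centred_gaussian_process CS (cov_sliding C))
    (disp2 : measure_display) (T2 : measurableType disp2)
    (P2 : probability T2 R) (CD : 'rV[R]_d -> {RV P2 >-> R})
    (hCD : centred_gaussian_process CD (cov_disjoint C))
    (k : nat) (u : 'I_k -> 'rV[R]_d) (hu : forall i, cube (u i)) :
  loewner_le (covmx P1 (fun i => hat_process C CS (u i)))
             (covmx P2 (fun i => hat_process C CD (u i))) /\
  loewner_le (covmx P1 (fun i => CS (u i)))
             (covmx P2 (fun i => CD (u i))).
Proof.
split; last first.
  have := loewner_le_lincomb hC hCS hCD (fun _ (_ : 'I_1) => 1) (fun i _ => u i)
    (fun i _ => hu i).
  congr (loewner_le (covmx P1 _) (covmx P2 _));
    by apply/funext => i; apply/funext => t; rewrite big_ord1 mul1r.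
(* Index 0 stands for the process at u_i, index j + 1 for its j-th margin. *)
pose c i (o : 'I_d.+1) :=
  if unlift ord0 o is Some j then - pdot C j (u i) else 1.
pose w i (o : 'I_d.+1) :=
  if unlift ord0 o is Some j then vmargin j (u i) else u i.
have cw i o : cube (w i o).
  by rewrite /w; case: unlift => [j|] //; exact: vmargin_cube.
have := loewner_le_lincomb hC hCS hCD c w cw.
congr (loewner_le (covmx P1 _) (covmx P2 _));
  apply/funext => i; apply/funext => t;
  rewrite big_ord_recl /c /w unlift_none mul1r /hat_process -sumrN;
  by congr (_ + _); apply: eq_bigr => j _; rewrite liftK mulNr.
Qed.
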